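(* Let $x=P(x)$ be a quadratic monotone polynomial system (MPS) in $n$ variables whose polynomials have rational coefficients, with total encoding size $|P|$ bits, and suppose its least fixed point $q^*\in\mathbb{R}^n_{\ge 0}$ satisfies $q^*>0$ (all coordinates positive). Then (1) $q^*_{\min}\ge 2^{-|P|(2^{n}-1)}$, and (2) $q^*_{\max}\le 2^{2(n+1)(|P|+2(n+1)\log(2n+2))\cdot 5^{n}}$, where $q^*_{\min}=\min_i q^*_i$ and $q^*_{\max}=\max_i q^*_i$.
   Context: An MPS is a system $x_i=P_i(x)$, $i=1,\dots,n$, where each $P_i$ is a multivariate polynomial in $x=(x_1,\dots,x_n)$ with nonnegative coefficients and nonnegative constant term. It is quadratic if every $P_i$ has total degree at most $2$. A least fixed point (LFP) is a solution $q^*\in\mathbb{R}^n_{\ge0}$ of $x=P(x)$ with $q^*\le a$ coordinatewise for every solution $a\in\mathbb{R}^n_{\ge 0}$. The encoding size $|P|$ is the number of bits used when each $P_i$ is given as a list of (coefficient, exponent vector) pairs, each rational coefficient given by numerator and denominator in binary and each exponent vector given sparsely by its nonzero coordinates (index and value in binary). Logarithms are base 2. *)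

(* Defs.v *)
From HB Require Import structures.
From mathcomp Require Import all_boot all_order all_algebra.
From mathcomp Require Import reals exp.
From mathcomp Require Import mpoly.

Set Implicit Arguments.
Unset Strict Implicit.
Unset Printing Implicit Defensive.

Import Order.TTheory GRing.Theory Num.Theory.
Local Open Scope ring_scope.

(* The constant term is the coefficient of the monomial 0, so it is covered. *)
Definition is_MPS (n : nat) (P : 'I_n -> {mpoly rat[n]}) : Prop :=
  forall (i : 'I_n) (m : 'X_{1..n}), 0 <= (P i)@_m.

(* [msize p] is one plus the total degree of [p], and 0 when [p = 0]. *)
Definition quadratic (n : nat) (P : 'I_n -> {mpoly rat[n]}) : Prop :=
  forall i : 'I_n, (msize (P i) <= 3)%N.

Definition nneg_fixpoint (R : realType) (n : nat) (P : 'I_n -> {mpoly rat[n]})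
    (x : 'I_n -> R) : Prop :=
  (forall i, 0 <= x i) /\ (forall i, x i = (map_mpoly ratr (P i)).@[x]).

Definition is_LFP (R : realType) (n : nat) (P : 'I_n -> {mpoly rat[n]})
    (q : 'I_n -> R) : Prop :=
  nneg_fixpoint P q /\
  forall a : 'I_n -> R, nneg_fixpoint P a -> forall i, q i <= a i.

(* Number of binary digits of [k]; 0 is written with one digit. *)
Definition bitlen (k : nat) : nat := (trunc_log 2 k).+1.

(* Numerator and denominator in lowest terms; all coefficients are nonnegative
   for an MPS, so there is no sign to record. *)
Definition coef_size (c : rat) : nat := (bitlen `|numq c| + bitlen `|denq c|)%N.

(* Variables are numbered from 1, whereas ordinals start at 0. *)
Definition expvec_size (n : nat) (m : 'X_{1..n}) : nat :=
  (\sum_(j < n | m j != 0) (bitlen j.+1 + bitlen (m j)))%N.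

Definition poly_size (n : nat) (p : {mpoly rat[n]}) : nat :=
  (\sum_(m <- msupp p) (coef_size p@_m + expvec_size m))%N.

(* Delimiters between the binary numbers are not counted; counting them would
   only enlarge the size, hence weaken bounds that are monotone in it. *)
Definition enc_size (n : nat) (P : 'I_n -> {mpoly rat[n]}) : nat :=
  (\sum_(i < n) poly_size (P i))%N.

Definition vec_min (R : realType) (n : nat) (n_gt0 : (0 < n)%N)
    (x : 'I_n -> R) : R :=
  \big[Num.min/x (Ordinal n_gt0)]_(i < n) x i.

Definition vec_max (R : realType) (n : nat) (n_gt0 : (0 < n)%N)
    (x : 'I_n -> R) : R :=
  \big[Num.max/x (Ordinal n_gt0)]_(i < n) x i.

Definition log2 (R : realType) (x : R) : R := ln x / ln 2.

(* Main.v *)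
Require Import Defs.
From mathcomp Require Import all_boot all_order all_algebra.
From mathcomp Require Import reals exp topology sequences.
(* The notations of [normedtype] are incompatible with those of [mpoly]. *)
From mathcomp Require Import -(notations) normedtype realfun.
From mathcomp Require Import mpoly.
From mathcomp Require Import perm polyXY ring lra.

Set Implicit Arguments.
Unset Strict Implicit.
Unset Printing Implicit Defensive.

Import Order.TTheory GRing.Theory Num.Theory.
Import numFieldNormedType.Exports.
Local Open Scope ring_scope.

(** Lower bound: the coordinates known to be positive grow by at least one at a
    time, so [n] rounds reach them all; a round multiplies at most two earlier
    coordinates with a coefficient that is at least [2 ^ - |P|].

    Upper bound: for [e > 0] the system [x_i + e x_i^3 = P_i(x)] has a least
    nonnegative solution, and these solutions increase to [q] as [e] tends to
    [0].  With [D] a common denominator and [u = 1 / (D e)] the system is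
    [x_i^3 = u (D P_i(x) - D x_i)], which rewrites every monomial as a
    combination over [Z[u]] of the [3^n] monomials with exponents at most [2].
    So [x_j] is an eigenvalue of a matrix over [Z[u]], a root of its
    characteristic polynomial [F] in [Z[u][t]], whose l1-norm [H] is under
    control.  As [u] tends to infinity the leading coefficient of [F] in [u]
    prevails; it is a nonzero polynomial in [Z[t]] of norm at most [H], so that
    [q_j <= H]. *)

(** * Seminorms on rings of polynomials *)

Record ring_seminorm (A : nzRingType) (K : numDomainType) (N : A -> K) : Prop :=
  RingSeminorm {
    seminorm0 : N 0 = 0;
    seminorm1 : N 1 = 1;
    seminormN : forall a, N (- a) = N a;
    ler_seminormD : forall a b, N (a + b) <= N a + N b;
    ler_seminormM : forall a b, N (a * b) <= N a * N b }.

Lemma normr_ring_seminorm (K : numDomainType) : ring_seminorm (@Num.norm K K).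
Proof.
by split; [exact: normr0|exact: normr1|exact: normrN|exact: ler_normD|
  move=> a b; rewrite normrM].
Qed.

Lemma comp_ring_seminorm (A B : nzRingType) (K : numDomainType) (N : B -> K)
  (phi : {rmorphism A -> B}) : ring_seminorm N -> ring_seminorm (N \o phi).
Proof.
move=> semiN; split=> /= [||a|a b|a b]; rewrite ?(rmorph0, rmorph1) //.
- exact: seminorm0.
- exact: seminorm1.
- by rewrite rmorphN seminormN.
- by rewrite rmorphD ler_seminormD.
- by rewrite rmorphM ler_seminormM.
Qed.

Section RingSeminorm.
Variables (A : nzRingType) (K : numDomainType) (N : A -> K).
Hypothesis semiN : ring_seminorm N.

Lemma seminorm_ge0 a : 0 <= N a.
Proof.
have := ler_seminormD semiN a (- a).
by rewrite subrr seminorm0 // seminormN // -mulr2n pmulrn_lge0.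
Qed.

Lemma seminorm_sign (b : bool) : N ((-1) ^+ b) = 1.
Proof. by case: b; rewrite ?expr1 ?seminormN // seminorm1. Qed.

Lemma ler_seminorm_sum (I : Type) (r : seq I) (F : I -> A) :
  N (\sum_(i <- r) F i) <= \sum_(i <- r) N (F i).
Proof.
elim/big_rec2: _ => [|i C a _ le_aC]; first by rewrite seminorm0.
by apply: le_trans (ler_seminormD semiN _ _) _; rewrite lerD2l.
Qed.

Lemma ler_seminorm_prod (I : Type) (r : seq I) (F : I -> A) :
  N (\prod_(i <- r) F i) <= \prod_(i <- r) N (F i).
Proof.
elim/big_rec2: _ => [|i C a _ le_aC]; first by rewrite seminorm1.
apply: le_trans (ler_seminormM semiN _ _) _.
by rewrite ler_wpM2l ?seminorm_ge0.
Qed.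

End RingSeminorm.

(* Expanding the product on the right yields one term for every selfmap of
   ['I_n]; the Leibniz formula only involves the permutations. *)
Lemma ler_seminorm_det (A : comNzRingType) (K : numDomainType) (N : A -> K) n
  (M : 'M[A]_n) : ring_seminorm N -> N (\det M) <= \prod_i \sum_j N (M i j).
Proof.
move=> semiN; pose term (h : {ffun 'I_n -> 'I_n}) := \prod_i N (M i (h i)).
have term_ge0 h : 0 <= term h by apply: prodr_ge0 => i _; apply: seminorm_ge0.
rewrite bigA_distr_bigA (bigID (mem [set finfun s | s : 'S_n])) /=.
apply: ler_wpDr; first by apply: sumr_ge0 => h _; apply: term_ge0.
rewrite big_imset => [|s t _ _ /ffunP eq_st] /=; last first.
  by apply/permP => i; have := eq_st i; rewrite !ffunE.
apply: le_trans (ler_seminorm_sum semiN _ _) _; apply: ler_sum => s _.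
apply: le_trans (ler_seminormM semiN _ _) _; rewrite seminorm_sign // mul1r.
apply: le_trans (ler_seminorm_prod semiN _ _) _.
by under [leRHS]eq_bigr do rewrite ffunE.
Qed.

Definition l1norm (A : nzRingType) (K : numDomainType) (N : A -> K)
  (p : {poly A}) : K := \sum_(i < size p) N p`_i.

Section L1Norm.
Variables (A : nzRingType) (K : numDomainType) (N : A -> K).
Hypothesis semiN : ring_seminorm N.
Implicit Types p q : {poly A}.

Lemma l1norm_widen k p : (size p <= k)%N -> l1norm N p = \sum_(i < k) N p`_i.
Proof.
move=> le_pk; rewrite /l1norm (big_ord_widen _ (fun i => N p`_i) le_pk).
rewrite big_mkcond; apply: eq_bigr => i _.
by case: ltnP => // /(nth_default 0) ->; rewrite seminorm0.
Qed.

Lemma seminorm_coef_le p i : N p`_i <= l1norm N p.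
Proof.
case: (ltnP i (size p)) => [lt_ip|le_pi]; last first.
  rewrite nth_default // seminorm0 // sumr_ge0 // => j _.
  exact: seminorm_ge0.
rewrite /l1norm (bigD1 (Ordinal lt_ip)) //= lerDl sumr_ge0 // => j _.
exact: seminorm_ge0.
Qed.

Lemma l1norm_cons p a : l1norm N (p * 'X + a%:P) = l1norm N p + N a.
Proof.
have size_le : (size (p * 'X + a%:P)%R <= (size p).+1)%N.
  by rewrite size_MXaddC; case: ifP.
rewrite (l1norm_widen size_le) big_ord_recl addrC coefD coefMX coefC add0r.
by congr (_ + _); apply: eq_bigr => i _; rewrite coefD coefMX coefC addr0.
Qed.

Lemma l1normC a : l1norm N a%:P = N a.
Proof.
have := l1norm_cons 0 a; rewrite mul0r add0r => ->.
by rewrite /l1norm size_poly0 big_ord0 add0r.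
Qed.

Lemma l1norm_MX p : l1norm N (p * 'X) = l1norm N p.
Proof. by have := l1norm_cons p 0; rewrite !addr0 seminorm0 // addr0. Qed.

Lemma l1normN p : l1norm N (- p) = l1norm N p.
Proof.
by rewrite /l1norm size_polyN; apply: eq_bigr => i _; rewrite coefN seminormN.
Qed.

Lemma ler_l1normD p q : l1norm N (p + q) <= l1norm N p + l1norm N q.
Proof.
pose k := maxn (size p) (size q).
rewrite (@l1norm_widen k) ?size_polyD // (@l1norm_widen k p) ?leq_maxl //.
rewrite (@l1norm_widen k q) ?leq_maxr // -big_split ler_sum // => i _.
by rewrite coefD ler_seminormD.
Qed.

Lemma ler_l1normZ a p : l1norm N (a *: p) <= N a * l1norm N p.
Proof.
rewrite (l1norm_widen (size_scale_leq a p)) mulr_sumr ler_sum // => i _.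
by rewrite coefZ ler_seminormM.
Qed.

Lemma ler_l1normM p q : l1norm N (p * q) <= l1norm N p * l1norm N q.
Proof.
elim/poly_ind: p => [|p a IHp].
  by rewrite mul0r /l1norm size_poly0 !big_ord0 mul0r.
rewrite mulrDl -mulrA -commr_polyX mulrA l1norm_cons mulrDl mul_polyC.
apply: le_trans (ler_l1normD _ _) _; rewrite l1norm_MX.
by apply: lerD (ler_l1normZ _ _).
Qed.

Lemma l1norm_ring_seminorm : ring_seminorm (l1norm N).
Proof.
split; [|by rewrite -[1]/(1%:P) l1normC seminorm1|exact: l1normN|
  exact: ler_l1normD|exact: ler_l1normM].
by rewrite /l1norm size_poly0 big_ord0.
Qed.

End L1Norm.

Lemma l1norm_map (A B : nzRingType) (K : numDomainType) (N : B -> K)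
    (phi : {rmorphism A -> B}) (p : {poly A}) :
  ring_seminorm N -> l1norm N (map_poly phi p) = l1norm (N \o phi) p.
Proof.
move=> semiN; rewrite (l1norm_widen semiN (size_poly _ _)).
by apply: eq_bigr => i _; rewrite coef_map.
Qed.

Lemma l1norm_swapXY (A : nzRingType) (K : numDomainType) (N : A -> K)
    (p : {poly {poly A}}) :
  ring_seminorm N -> l1norm (l1norm N) (swapXY p) = l1norm (l1norm N) p.
Proof.
move=> semiN.
have l1normE (q : {poly {poly A}}) k l : (size q <= k)%N -> (sizeY q <= l)%N ->
    l1norm (l1norm N) q = \sum_(i < k) \sum_(j < l) N q`_i`_j.
  move=> le_qk le_ql; rewrite (l1norm_widen (l1norm_ring_seminorm semiN) le_qk).
  apply: eq_bigr => i _; apply: l1norm_widen => //.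
  exact: leq_trans (max_size_coefXY _ _) le_ql.
rewrite (l1normE _ (sizeY p) (size p)) ?(l1normE p (size p) (sizeY p)) //.
- rewrite exchange_big; apply: eq_bigr => i _; apply: eq_bigr => j _.
  by rewrite coef_swapXY.
- by rewrite sizeYE.
- by rewrite sizeYE swapXYK.
Qed.

Lemma l1norm_char_poly_le (A : comNzRingType) (K : numDomainType) (N : A -> K) n
    (M : 'M[A]_n) (C : K) :
    ring_seminorm N -> (forall j, \sum_i N (M i j) <= C) ->
  l1norm N (char_poly M) <= (1 + C) ^+ n.
Proof.
move=> semiN col_le; have semiL := l1norm_ring_seminorm semiN.
rewrite /char_poly -det_tr; apply: le_trans (ler_seminorm_det _ semiL) _.
rewrite -[n in leRHS]card_ord -prodr_const; apply: ler_prod => j _.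
rewrite sumr_ge0 => [|i _]; last exact: seminorm_ge0.
apply: (@le_trans _ _ (\sum_i ((i == j)%:R + N (M i j)))).
  apply: ler_sum => i _; rewrite !mxE.
  apply: le_trans (ler_seminormD semiL _ _) _.
  rewrite (seminormN semiL) l1normC // lerD2r.
  case: eqP => _; last by rewrite mulr0n seminorm0.
  by rewrite mulr1n -['X]mul1r l1norm_MX // seminorm1.
rewrite big_split /= lerD // (bigD1 j) //= eqxx big1 ?addr0 // => i.
by move/negPf ->.
Qed.

(** * Roots of bivariate integer polynomials *)

Lemma norm_horner_ge1 (R : numDomainType) (p : {poly R}) (u : R) :
  1 <= `|lead_coef p| -> l1norm Num.norm p <= `|u| -> 1 <= `|p.[u]|.
Proof.
rewrite lead_coefE horner_coef /l1norm.
case size_p: (size p) => [|k /=].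
  by rewrite nth_default ?size_p // normr0 ler10.
rewrite !big_ord_recr /=; set S := \sum_(i < k) `|_| => lead_ge1 le_u.
have S_ge0 : 0 <= S by apply: sumr_ge0.
have u_ge1 : 1 <= `|u|.
  by rewrite (le_trans lead_ge1) // (le_trans _ le_u) // lerDr.
case: k => [|k] in size_p S lead_ge1 le_u S_ge0 *.
  by rewrite big_ord0 add0r mulr1.
have tail_le : `|\sum_(i < k.+1) p`_i * u ^+ i| <= S * `|u| ^+ k.
  rewrite mulr_suml; apply: le_trans (ler_norm_sum _ _ _) _.
  apply: ler_sum => i _.
  by rewrite normrM normrX ler_wpM2l // ler_weXn2l // -ltnS.
rewrite addrC; apply: le_trans (lerB_normD _ _).
rewrite normrM normrX exprS mulrA; apply: le_trans (lerB (lexx _) tail_le).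
rewrite -mulrBl mulr_ege1 ?exprn_ege1 //.
apply: (@le_trans _ _ (`|u| - S)).
  by rewrite lerBrDl (le_trans _ le_u) // lerD2l.
by rewrite lerD2r ler_peMl.
Qed.

(* For large [u] the value of [G] at [y = u] is governed by its leading
   coefficient in [y], a polynomial in [x] that [norm_horner_ge1] bounds from
   below. *)
Lemma bivariate_root_le (R : realDomainType) (G : {poly {poly R}}) (b : R) :
    1 <= `|lead_coef (lead_coef (swapXY G))| ->
  exists2 u0, 0 < u0 & forall u t, u0 <= u -> 0 <= t <= b -> G.[t, u] = 0 ->
    t <= l1norm (l1norm Num.norm) G.
Proof.
set r := lead_coef (swapXY G) => lead_ge1.
have semiR := normr_ring_seminorm R.
pose bound i := sval (poly_itv_bound (swapXY G)`_i 0 b).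
pose C := \sum_(i < size (swapXY G)) bound i.
exists (Num.max 1 C) => [|u t]; first by rewrite lt_max ltr01.
rewrite ge_max => /andP[u_ge1 le_Cu] t_itv Gtu0.
rewrite -l1norm_swapXY // leNgt; apply/negP => lt_t.
have r_ge1 : 1 <= `|r.[t]|.
  apply: norm_horner_ge1 => //; rewrite ger0_norm; last by case/andP: t_itv.
  apply: le_trans (ltW lt_t); rewrite /r lead_coefE.
  exact: seminorm_coef_le (l1norm_ring_seminorm semiR) _ _.
suff: 1 <= `|G.[t, u]| by rewrite Gtu0 normr0 ler10.
rewrite horner_polyC; apply: norm_horner_ge1.
  by rewrite lead_coef_map_eq // -normr_gt0 (lt_le_trans ltr01).
rewrite ger0_norm ?(le_trans ler01) // (le_trans _ le_Cu) //.
rewrite (l1norm_widen semiR (size_poly _ _)) ler_sum // => i _.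
by rewrite coef_map; apply: (svalP (poly_itv_bound (swapXY G)`_i 0 b)).
Qed.

Local Notation int_norm R := (@Num.norm R R \o (intr : int -> R)).

Lemma int_norm_ring_seminorm (R : numDomainType) : ring_seminorm (int_norm R).
Proof. exact: comp_ring_seminorm (normr_ring_seminorm R). Qed.

Lemma int_bivariate_root_le (R : realDomainType) (F : {poly {poly int}})
    (b : R) : F != 0 ->
  exists2 u0, 0 < u0 & forall u t, u0 <= u -> 0 <= t <= b ->
    (map_poly (map_poly intr) F).[t, u] = 0 ->
    t <= l1norm (l1norm (int_norm R)) F.
Proof.
move=> F_neq0; set FR := map_poly _ F.
have semiR := normr_ring_seminorm R.
have intr_map_inj : injective (map_poly (intr : int -> R)).
  exact: map_inj_poly intr_inj (rmorph0 _).
have [|u0 u0_gt0 root_le] := @bivariate_root_le R FR b.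
  rewrite /FR swapXY_map !lead_coef_map_inj ?rmorph0 //; last exact: intr_inj.
  set a := lead_coef _; rewrite -intr_norm ler1z -gtz0_ge1 normr_gt0 /a.
  by rewrite !lead_coef_eq0 swapXY_eq0.
exists u0 => // u t le_u t_itv root_t.
apply: le_trans (root_le u t le_u t_itv root_t) _.
rewrite (l1norm_map _ _ (l1norm_ring_seminorm semiR)).
apply: ler_sum => i _ /=.
by rewrite l1norm_map.
Qed.

(** * Elimination *)

Section MonomialEvaluation.
Variables (n : nat) (S : comNzRingType).
Implicit Types (x : 'I_n -> S) (m : 'X_{1..n}).

Lemma mmap1D x m1 m2 : mmap1 x (m1 + m2)%MM = mmap1 x m1 * mmap1 x m2.
Proof. by apply: commr_mmap1_M => i y; apply: mulrC. Qed.

Lemma mmap1Mn x m k : mmap1 x (m *+ k)%MM = mmap1 x m ^+ k.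
Proof.
by rewrite /mmap1 -prodrXl; apply: eq_bigr => i _; rewrite mulmnE exprM.
Qed.

End MonomialEvaluation.

Lemma mnm_subMnUK n (m : 'X_{1..n}) i k :
  (k <= m i)%N -> (m - U_(i) *+ k + U_(i) *+ k)%MM = m.
Proof.
move=> le_k; rewrite submK //; apply/mnm_lepP => j; rewrite mulmnE mnm1E.
by case: eqP => [<-|]; rewrite ?mul1n.
Qed.

(* A system [x_i ^ (d + 1) = G_i(x)] with [deg G_i <= d] rewrites every
   monomial as a linear combination of the [(d + 1) ^ n] monomials whose
   exponents are all at most [d]; multiplication by [x_j] on their span is then
   a matrix with eigenvalue [x_j]. *)
Section Elimination.
Variables (A : comNzRingType) (K : numDomainType) (N : A -> K) (L : fieldType).
Variables (n d : nat) (G : 'I_n -> seq (A * 'X_{1..n})) (B : K).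
Hypotheses (semiN : ring_seminorm N) (B_ge1 : 1 <= B).
Hypothesis G_norm_le : forall i, \sum_(g <- G i) N g.1 <= B.
Hypothesis G_deg_le : forall i g, g \in G i -> (mdeg g.2 <= d)%N.

Let B_ge0 : 0 <= B. Proof. exact: le_trans ler01 B_ge1. Qed.

Definition solves_power_system (ev : {rmorphism A -> L}) (x : 'I_n -> L) :
    Prop :=
  forall i, x i ^+ d.+1 = \sum_(g <- G i) ev g.1 * mmap1 x g.2.

Local Notation box := {ffun 'I_n -> 'I_d.+1}.

Definition box_mnm (b : box) : 'X_{1..n} := [multinom (b i : nat) | i < n].

Definition box_spanned (C : K) (phi : {rmorphism A -> L} -> ('I_n -> L) -> L) :
    Prop :=
  exists2 c : box -> A, \sum_b N (c b) <= C &
    forall ev x, solves_power_system ev x ->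
      phi ev x = \sum_b ev (c b) * mmap1 x (box_mnm b).

Lemma box_spanned0 : box_spanned 0 (fun _ _ => 0).
Proof.
exists (fun=> 0) => [|ev x _]; first by rewrite seminorm0 // big1.
by rewrite big1 // => b _; rewrite rmorph0 mul0r.
Qed.

Lemma box_spanned_mnm b : box_spanned 1 (fun _ x => mmap1 x (box_mnm b)).
Proof.
exists (fun b' => (b' == b)%:R) => [|ev x _].
  rewrite (bigD1 b) //= eqxx seminorm1 // big1 ?addr0 // => b' /negPf->.
  exact: seminorm0.
rewrite (bigD1 b) //= eqxx rmorph1 mul1r big1 ?addr0 // => b' /negPf->.
by rewrite rmorph0 mul0r.
Qed.

Lemma box_spannedD C1 C2 phi psi :
    box_spanned C1 phi -> box_spanned C2 psi ->
  box_spanned (C1 + C2) (fun ev x => phi ev x + psi ev x).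
Proof.
move=> [c1 c1_le phiE] [c2 c2_le psiE].
exists (fun b => c1 b + c2 b) => [|ev x sol].
  apply: le_trans (lerD c1_le c2_le); rewrite -big_split.
  by apply: ler_sum => b _; apply: ler_seminormD.
rewrite phiE // psiE // -big_split; apply: eq_bigr => b _.
by rewrite rmorphD mulrDl.
Qed.

Lemma box_spannedZ a C phi :
  box_spanned C phi -> box_spanned (N a * C) (fun ev x => ev a * phi ev x).
Proof.
move=> [c c_le phiE]; exists (fun b => a * c b) => [|ev x sol].
  apply: le_trans (ler_wpM2l (seminorm_ge0 semiN a) c_le); rewrite mulr_sumr.
  by apply: ler_sum => b _; apply: ler_seminormM.
by rewrite phiE // mulr_sumr; apply: eq_bigr => b _; rewrite rmorphM mulrA.
Qed.

Lemma box_spannedW C1 C2 phi :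
  C1 <= C2 -> box_spanned C1 phi -> box_spanned C2 phi.
Proof. by move=> le12 [c c_le phiE]; exists c; first exact: le_trans le12. Qed.

Lemma box_spanned_sum C (s : seq (A * 'X_{1..n})) (m : 'X_{1..n}) :
    (forall g, g \in s -> box_spanned C (fun _ x => mmap1 x (m + g.2)%MM)) ->
  box_spanned ((\sum_(g <- s) N g.1) * C)
    (fun ev x => \sum_(g <- s) ev g.1 * mmap1 x (m + g.2)%MM).
Proof.
elim: s => [_|g s IHs span_s].
  have [c c_le cE] := box_spanned0; exists c => [|ev x sol].
    by rewrite big_nil mul0r.
  by rewrite big_nil; apply: cE.
have span_tail h : h \in s -> box_spanned C (fun _ x => mmap1 x (m + h.2)%MM).
  by move=> h_s; apply: span_s; rewrite inE h_s orbT.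
have [c c_le cE] :=
  box_spannedD (box_spannedZ g.1 (span_s g (mem_head _ _))) (IHs span_tail).
exists c => [|ev x sol]; first by rewrite big_cons mulrDl.
by rewrite big_cons cE.
Qed.

Lemma box_spanned_monomial m : box_spanned (B ^+ mdeg m) (fun _ x => mmap1 x m).
Proof.
have [k] := ubnP (mdeg m); elim: k m => // k IHk m lt_mk.
have [/forallP in_box|] := boolP [forall i, m i < d.+1]%N.
  have -> : m = box_mnm [ffun i => Ordinal (in_box i)].
    by apply/mnmP => i; rewrite mnmE ffunE.
  by apply: box_spannedW (box_spanned_mnm _); rewrite exprn_ege1.
rewrite negb_forall => /existsP[i]; rewrite -leqNgt => d_lt.
set m' := (m - U_(i) *+ d.+1)%MM; have mE := esym (mnm_subMnUK d_lt).
have mdegE : mdeg m = (mdeg m' + d).+1.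
  by rewrite {1}mE mdegD mdegMn mdeg1 mul1n addnS.
have span_g g : g \in G i ->
    box_spanned (B ^+ (mdeg m' + d)) (fun _ x => mmap1 x (m' + g.2)%MM).
  move=> g_Gi; have deg_le : (mdeg (m' + g.2)%MM <= mdeg m' + d)%N.
    by rewrite mdegD leq_add2l (G_deg_le g_Gi).
  apply: box_spannedW (IHk _ _); first exact: ler_weXn2l.
  by rewrite -ltnS (leq_trans _ lt_mk) // ltnS mdegE ltnS.
have [c c_le cE] := box_spanned_sum span_g; exists c => [|ev x sol].
  by apply: le_trans c_le _; rewrite mdegE exprS ler_wpM2r ?exprn_ge0.
rewrite -cE // mE mmap1D mmap1Mn mmap1U sol mulr_sumr -/m'.
by apply: eq_bigr => g _; rewrite mmap1D mulrCA.
Qed.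

Lemma exists_eliminant j : exists F : {poly A},
  [/\ F \is monic, l1norm N F <= (1 + B ^+ (d * n + 1)) ^+ (d.+1 ^ n) &
    forall ev x, solves_power_system ev x -> root (map_poly ev F) (x j)].
Proof.
pose mon b := (box_mnm b + U_(j))%MM.
have mon_deg_le b : (mdeg (mon b) <= d * n + 1)%N.
  rewrite mdegD mdeg1 leq_add2r mdegE mulnC -[in leqRHS](card_ord n).
  by rewrite -sum_nat_const leq_sum // => i _; rewrite mnmE -ltnS.
have /fin_all_exists2[c c_le cE] := fun b => box_spanned_monomial (mon b).
pose M : 'M[A]_#|box| := \matrix_(a, b) c (enum_val b) (enum_val a).
exists (char_poly M); split=> [||ev x sol]; first exact: char_poly_monic.
  have -> : (d.+1 ^ n)%N = #|box| by rewrite card_ffun !card_ord.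
  apply: l1norm_char_poly_le => // b.
  apply: le_trans (le_trans (c_le (enum_val b)) _); last exact: ler_weXn2l.
  rewrite [leRHS](reindex _ (onW_bij _ (enum_val_bij box))).
  by apply: ler_sum => a _; rewrite mxE.
rewrite map_char_poly -eigenvalue_root_char.
apply/eigenvalueP; exists (\row_a mmap1 x (box_mnm (enum_val a))).
  apply/rowP => b; rewrite !mxE -[x j](mmap1U x) mulrC -mmap1D.
  rewrite (cE _ ev) // (reindex _ (onW_bij _ (enum_val_bij box))).
  by apply: eq_bigr => a _; rewrite !mxE mulrC.
apply/eqP => /rowP/(_ (enum_rank [ffun=> ord0])); rewrite !mxE enum_rankK.
rewrite /mmap1 big1 => [/eqP|i _]; first by rewrite oner_eq0.
by rewrite mnmE ffunE.
Qed.

End Elimination.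

(** * Least fixed points of monotone maps and their perturbations *)

Definition nonneg (R : numDomainType) (I : Type) (x : I -> R) : Prop :=
  forall i, 0 <= x i.

Definition le_pointwise (R : numDomainType) (I : Type) (x y : I -> R) : Prop :=
  forall i, x i <= y i.

Local Infix "<=1" := le_pointwise (at level 70).

Section LeastFixpoint.
Variables (R : realType) (I : Type).
Implicit Types (f : (I -> R) -> I -> R) (x y z q : I -> R).

Definition monotone_map f : Prop :=
  (forall x, nonneg x -> nonneg (f x)) /\
  (forall x y, nonneg x -> x <=1 y -> f x <=1 f y).

Definition least_fixpoint f z : Prop :=
  [/\ nonneg z, f z =1 z & forall y, nonneg y -> f y <=1 y -> z <=1 y].

Lemma le_pointwise_trans y x z : x <=1 y -> y <=1 z -> x <=1 z.
Proof. by move=> le_xy le_yz i; apply: le_trans (le_xy i) (le_yz i). Qed.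

(* The pointwise infimum of the nonnegative prefixed points (Knaster-Tarski). *)
Lemma exists_least_fixpoint f q :
  monotone_map f -> nonneg q -> f q <=1 q -> exists z, least_fixpoint f z.
Proof.
move=> [f_ge0 f_mono] q_ge0 fq_le.
pose values i t := exists2 y, nonneg y /\ f y <=1 y & t = y i.
have values_lb i : classical_sets.has_lbound (values i).
  by exists 0 => _ [y [y_ge0 _] ->].
have values_nonempty i : classical_sets.nonempty (values i).
  by exists (q i), q.
pose z i := inf (values i).
have z_ge0 : nonneg z by move=> i; apply: lb_le_inf => // _ [y [y_ge0 _] ->].
have z_le y : nonneg y -> f y <=1 y -> z <=1 y.
  by move=> y_ge0 fy_le i; apply: (ge_inf (values_lb i)); exists y.
have fz_le : f z <=1 z.
  move=> i; apply: lb_le_inf => // _ [y [y_ge0 fy_le] ->].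
  by apply: le_trans (fy_le i); apply: f_mono => //; apply: z_le.
exists z; split=> // i; apply/le_anti; rewrite fz_le /=.
by apply: z_le; [exact: f_ge0|apply: f_mono => //; exact: f_ge0].
Qed.

Lemma least_fixpointP f q :
    monotone_map f -> nonneg q -> f q =1 q ->
    (forall y, nonneg y -> f y =1 y -> q <=1 y) ->
  least_fixpoint f q.
Proof.
move=> f_mono q_ge0 fq q_least; split=> // y y_ge0 fy_le.
have [z [z_ge0 fz z_le]] := exists_least_fixpoint f_mono y_ge0 fy_le.
exact: le_pointwise_trans (q_least z z_ge0 fz) (z_le y y_ge0 fy_le).
Qed.

End LeastFixpoint.

Section Perturbation.
Variables (R : realType) (I : Type) (d : nat).
Implicit Types (f : (I -> R) -> I -> R) (x y z q : I -> R) (e s t : R).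

Definition perturb e t : R := t + e * t ^+ d.

Lemma perturb0 t : perturb 0 t = t.
Proof. by rewrite /perturb mul0r addr0. Qed.

Lemma perturb_ge e t : 0 <= e -> 0 <= t -> t <= perturb e t.
Proof. by move=> e_ge0 t_ge0; rewrite lerDl mulr_ge0 ?exprn_ge0. Qed.

Lemma perturb_le_inj e s t :
  0 <= e -> 0 <= t -> perturb e s <= perturb e t -> s <= t.
Proof.
move=> e_ge0 t_ge0; apply: contraTT; rewrite -!ltNge => lt_ts.
rewrite ltr_leD // ler_wpM2l // lerXn2r ?nnegrE // ltW //.
exact: le_lt_trans lt_ts.
Qed.

Lemma perturb_onto e t :
  (0 < d)%N -> 0 <= e -> 0 <= t -> exists2 s, 0 <= s & perturb e s = t.
Proof.
move=> d_gt0 e_ge0 t_ge0; pose p : {poly R} := 'X + e *: 'X^d - t%:P.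
have pE s : p.[s] = perturb e s - t by rewrite !hornerE.
have [|s /andP[s_ge0 _] /rootP] := @poly_ivt R p 0 t t_ge0.
  rewrite !pE subr_ge0 perturb_ge // /perturb expr0n gtn_eqF // mulr0 !add0r.
  by rewrite oppr_le0 t_ge0.
by rewrite pE => /subr0_eq; exists s.
Qed.

Definition least_perturbed_solution f e z : Prop :=
  [/\ nonneg z, forall i, perturb e (z i) = f z i
    & forall y, nonneg y -> (forall i, f y i <= perturb e (y i)) -> z <=1 y].

Lemma exists_least_perturbed_solution f q e :
    (0 < d)%N -> 0 <= e -> monotone_map f -> nonneg q -> f q <=1 q ->
  exists z, least_perturbed_solution f e z.
Proof.
move=> d_gt0 e_ge0 [f_ge0 f_mono] q_ge0 fq_le.
have /boolp.choice[inv invP] t :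
    exists s, 0 <= t -> 0 <= s /\ perturb e s = t.
  case: (lerP 0 t) => [t_ge0|_]; last by exists 0.
  by have [s s_ge0 sK] := perturb_onto d_gt0 e_ge0 t_ge0; exists s.
pose g x i := inv (f x i).
have g_ge0 x : nonneg x -> nonneg (g x).
  by move=> x_ge0 i; have [] := invP _ (f_ge0 x x_ge0 i).
have gK x i : nonneg x -> perturb e (g x i) = f x i.
  by move=> x_ge0; have [] := invP _ (f_ge0 x x_ge0 i).
have g_mono : monotone_map g.
  split=> // x y x_ge0 le_xy i; have y_ge0 : nonneg y.
    by move=> k; apply: le_trans (le_xy k).
  by apply: (perturb_le_inj e_ge0); rewrite ?gK ?g_ge0 ?f_mono.
have g_prefixed y :
    nonneg y -> (forall i, f y i <= perturb e (y i)) -> g y <=1 y.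
  by move=> y_ge0 fy_le i; apply: (perturb_le_inj e_ge0) => //; rewrite gK.
have [|z [z_ge0 gz z_le]] := exists_least_fixpoint g_mono q_ge0.
  by apply: g_prefixed => // i; apply: le_trans (perturb_ge _ _).
exists z; split=> // [i|y y_ge0 fy_le]; first by rewrite -gK // gz.
by apply: z_le => //; apply: g_prefixed.
Qed.

Lemma least_perturbed_solution_anti f e1 e2 z1 z2 :
    0 <= e1 -> e1 <= e2 ->
    least_perturbed_solution f e1 z1 -> least_perturbed_solution f e2 z2 ->
  z2 <=1 z1.
Proof.
move=> e1_ge0 le_e12 [z1_ge0 z1E _] [_ _ z2_le]; apply: z2_le => // i.
by rewrite -z1E lerD2l ler_wpM2r ?exprn_ge0.
Qed.

Lemma least_perturbed_solution_le f e q z :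
    0 <= e -> least_fixpoint f q -> least_perturbed_solution f e z -> z <=1 q.
Proof.
move=> e_ge0 [q_ge0 fq _] [_ _ z_le]; apply: z_le => // i.
by rewrite fq perturb_ge.
Qed.

Local Open Scope classical_set_scope.

Definition seq_continuous f : Prop :=
  forall (z : nat -> I -> R) x, (forall i, z k i @[k --> \oo] --> x i) ->
  forall i, f (z k) i @[k --> \oo] --> f x i.

Lemma perturbed_limit_fixpoint f (e : nat -> R) (z : nat -> I -> R) x :
    seq_continuous f -> e k @[k --> \oo] --> 0 ->
    (forall i, z k i @[k --> \oo] --> x i) ->
    (forall k i, perturb (e k) (z k i) = f (z k) i) ->
  f x =1 x.
Proof.
move=> f_cont e_cvg0 z_cvg zE i.
have : perturb (e k) (z k i) @[k --> \oo] --> perturb 0 (x i).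
  apply: cvgD => //; apply: cvgM => //.
  exact: (cvg_comp _ _ (z_cvg i) (@exprn_continuous _ d (x i))).
rewrite (eq_cvg _ _ (zE ^~ i)) perturb0; exact: cvg_unique (f_cont z x z_cvg i).
Qed.

Lemma perturbed_solutions_cvg f q :
    (0 < d)%N -> monotone_map f -> seq_continuous f -> least_fixpoint f q ->
  exists z : nat -> I -> R,
    [/\ forall k i, 0 <= z k i <= q i,
        forall k i, perturb k.+1%:R^-1 (z k i) = f (z k) i
      & forall i, z k i @[k --> \oo] --> q i].
Proof.
move=> d_gt0 f_mono f_cont q_lfp; have [q_ge0 fq q_least] := q_lfp.
have /boolp.choice[z zP] k :
    exists z, least_perturbed_solution f k.+1%:R^-1 z.
  apply: exists_least_perturbed_solution d_gt0 _ f_mono q_ge0 _ => [|i].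
    by rewrite invr_ge0.
  by rewrite fq.
have z_ge0 k : nonneg (z k) by have [] := zP k.
have zE k i : perturb k.+1%:R^-1 (z k i) = f (z k) i by have [] := zP k.
have z_le_q k : z k <=1 q.
  by apply: least_perturbed_solution_le q_lfp (zP k); rewrite invr_ge0.
pose L i := sup (classical_sets.range (z ^~ i)).
have z_cvg i : z k i @[k --> \oo] --> L i.
  apply: nondecreasing_cvgn => [k l le_kl|]; last first.
    by exists (q i) => _ [k _ <-]; apply: z_le_q.
  by apply: least_perturbed_solution_anti (zP l) (zP k) i;
    rewrite ?invr_ge0 ?lef_pV2 ?posrE ?ler_nat.
have fL : f L =1 L.
  apply: perturbed_limit_fixpoint f_cont cvg_harmonic z_cvg _ => k i.
  exact: zE.
have L_ge0 : nonneg L.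
  by move=> i; apply: (cvgr_to_ge (z_cvg i)); apply: nearW => k; apply: z_ge0.
have le_qL : q <=1 L by apply: q_least => // i; rewrite fL.
exists z; split=> // [k i|i]; first by rewrite z_ge0 z_le_q.
suff -> : q i = L i by [].
apply/le_anti; rewrite le_qL /=; apply: (cvgr_to_le (z_cvg i)).
by apply: nearW => k; apply: z_le_q.
Qed.

End Perturbation.

(** * Polynomial systems *)

Section MonomialOrder.
Variables (R : numDomainType) (n : nat).
Implicit Types (x y : 'I_n -> R) (m : 'X_{1..n}).

Lemma mmap1_ge0 x m : nonneg x -> 0 <= mmap1 x m.
Proof. by move=> x_ge0; apply: prodr_ge0 => i _; apply: exprn_ge0. Qed.

Lemma mmap1_mono x y m : nonneg x -> x <=1 y -> mmap1 x m <= mmap1 y m.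
Proof.
move=> x_ge0 le_xy; apply: ler_prod => i _; rewrite exprn_ge0 //=.
by rewrite lerXn2r ?nnegrE // (le_trans (x_ge0 i)).
Qed.

End MonomialOrder.

Section PositiveSystem.
Variables (R : realType) (n : nat) (Q : 'I_n -> {mpoly R[n]}).
Implicit Types (x y : 'I_n -> R).

Definition sys_eval x i : R := (Q i).@[x].

Lemma sys_evalE x i :
  sys_eval x i = \sum_(m <- msupp (Q i)) (Q i)@_m * mmap1 x m.
Proof. exact: mevalE. Qed.

Lemma sys_eval_continuous : seq_continuous sys_eval.
Proof.
move=> z x z_cvg i; rewrite sys_evalE (eq_cvg _ _ (fun k => sys_evalE (z k) i)).
apply: (cvg_big (@add_continuous R)) => m _; apply: cvgM; first exact: cvg_cst.
apply: (cvg_big (@mul_continuous R)) => j _.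
exact: (cvg_comp _ _ (z_cvg j) (@exprn_continuous _ (m j) (x j))).
Qed.

Hypothesis coef_ge0 : forall i m, 0 <= (Q i)@_m.

Lemma sys_eval_monotone : monotone_map sys_eval.
Proof.
split=> [x x_ge0 i|x y x_ge0 le_xy i]; rewrite !sys_evalE.
  by rewrite sumr_ge0 // => m _; rewrite mulr_ge0 ?mmap1_ge0.
by rewrite ler_sum // => m _; rewrite ler_wpM2l ?mmap1_mono.
Qed.

Variable q : 'I_n -> R.
Hypotheses (q_lfp : least_fixpoint sys_eval q) (q_gt0 : forall i, 0 < q i).

Let q_ge0 : nonneg q. Proof. by case: q_lfp. Qed.

Definition positivity_step (S : {set 'I_n}) : {set 'I_n} :=
  [set i | has (fun m : 'X_{1..n} => [forall j, (m j != 0) ==> (j \in S)])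
               (msupp (Q i))].

Lemma positivity_step_mono : {homo positivity_step : S T / S \subset T}.
Proof.
move=> S T /subsetP subST; apply/subsetP => i; rewrite !inE.
apply: sub_has => m /forallP mS; apply/forallP => j; apply/implyP => mj.
by apply: subST; have := mS j; rewrite mj.
Qed.

(* Restricting [q] to the fixed set gives a prefixed point, hence above [q]. *)
Lemma fixset_positivity_step i : i \in fixset positivity_step.
Proof.
set S := fixset _; pose y j : R := if j \in S then q j else 0.
have y_ge0 : nonneg y by move=> j; rewrite /y; case: ifP => // _; apply: q_ge0.
have le_yq : y <=1 q by move=> j; rewrite /y; case: ifP => // _; apply: q_ge0.
suff fy_le : sys_eval y <=1 y.
  have [_ _ /(_ y y_ge0 fy_le i)] := q_lfp; rewrite /y; case: ifP => // _.
  by rewrite leNgt q_gt0.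
move=> j; rewrite {2}/y; case: ifP => [_|/negbT].
  have [_ q_mono] := sys_eval_monotone; have [_ fq _] := q_lfp.
  by rewrite -fq; apply: q_mono.
rewrite -[S](fixsetK positivity_step_mono) -/S inE => /hasPn not_supported.
rewrite sys_evalE big_seq big1 // => m /not_supported.
rewrite negb_forall => /existsP[k]; rewrite negb_imply => /andP[mk k_notin].
rewrite /mmap1 (bigD1 k) //= /y (negPf k_notin) expr0n (negPf mk).
by rewrite mul0r mulr0.
Qed.

Variables (d : nat) (c : R).
Hypothesis size_le : forall i, (msize (Q i) <= d.+1)%N.
Hypotheses (c_itv : 0 <= c <= 1).
Hypothesis coef_ge : forall i m, m \in msupp (Q i) -> c <= (Q i)@_m.

Lemma positivity_step_lower_bound (S : {set 'I_n}) (b : R) :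
    0 <= b <= 1 -> (forall i, i \in S -> b <= q i) ->
  forall i, i \in positivity_step S -> c * b ^+ d <= q i.
Proof.
move=> /andP[b_ge0 b_le1] S_ge i; rewrite inE => /hasP[m m_supp /forallP mS].
have deg_le : (mdeg m <= d)%N.
  by rewrite -ltnS (leq_trans (msize_mdeg_lt m_supp)).
have [_ <- _] := q_lfp; rewrite sys_evalE (bigD1_seq m) ?msupp_uniq //=.
apply: ler_wpDr.
  by apply: sumr_ge0 => k _; rewrite mulr_ge0 ?mmap1_ge0.
case/andP: c_itv => c_ge0 _; apply: ler_pM; rewrite ?exprn_ge0 ?coef_ge //.
apply: le_trans (ler_wiXn2l b_ge0 b_le1 deg_le) _.
rewrite mdegE -prodrXr; apply: ler_prod => j _; rewrite exprn_ge0 //=.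
have := mS j; case: eqP => [-> //|_ /= jS].
by rewrite lerXn2r ?nnegrE ?S_ge ?q_ge0.
Qed.

Lemma least_fixpoint_lower_bound i : c ^+ (\sum_(k < n) d ^ k) <= q i.
Proof.
case/andP: c_itv => c_ge0 c_le1.
have iter_bound k j : j \in iter k positivity_step finset.set0 ->
    c ^+ (\sum_(l < k) d ^ l) <= q j.
  elim: k j => [|k IHk] j; first by rewrite inE.
  have -> : (\sum_(l < k.+1) d ^ l = 1 + (\sum_(l < k) d ^ l) * d)%N.
    rewrite big_ord_recl expn0 big_distrl; congr addn.
    by apply: eq_bigr => l _; rewrite expnSr.
  rewrite exprD expr1 exprM iterS; apply: positivity_step_lower_bound => //.
  by rewrite exprn_ge0 ?exprn_ile1.
have := fixset_positivity_step i; rewrite /fixset card_ord.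
exact: iter_bound.
Qed.

End PositiveSystem.

Lemma leq_addn_sum_prodS (I : Type) (r : seq I) (F : I -> nat) :
  (1 + \sum_(i <- r) F i <= \prod_(i <- r) (F i).+1)%N.
Proof.
elim: r => [|i r IHr]; first by rewrite !big_nil.
by rewrite !big_cons mulSn addnCA addnC leq_add // leq_pmulr // prodn_gt0.
Qed.

Lemma ltn_bitlen k : (k < 2 ^ bitlen k)%N.
Proof. exact: trunc_log_ltn. Qed.

Lemma ratr_ge_exp_coef_size (R : realFieldType) (c : rat) :
  0 < c -> 2 ^- coef_size c <= ratr c :> R.
Proof.
move=> c_gt0; have num_ge1 : 1 <= (numq c)%:~R :> R.
  by rewrite ler1z -gtz0_ge1 numq_gt0.
apply: (@le_trans _ _ (denq c)%:~R^-1); last first.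
  by rewrite /ratr ler_peMl // invr_ge0 ler0z denq_ge0.
rewrite lef_pV2 ?posrE ?exprn_gt0 ?ltr0z ?denq_gt0 //.
rewrite -[denq c]gtz0_abs ?denq_gt0 // -[_%:~R]/(_%:R) -natrX ler_nat.
apply: leq_trans (ltnW (ltn_bitlen _)) _.
by rewrite leq_exp2l // leq_addl.
Qed.

Section ClearedDenominators.
Variables (n : nat) (p : {mpoly rat[n]}).

Lemma coef_size_le_poly_size m :
  m \in msupp p -> (coef_size p@_m <= poly_size p)%N.
Proof.
move=> m_supp; rewrite /poly_size (bigD1_seq m) ?msupp_uniq //=.
by rewrite -addnA leq_addr.
Qed.

Definition den_prod : nat := (\prod_(m <- msupp p) `|denq p@_m|)%N.

Definition num_prod : nat := (\prod_(m <- msupp p) (`|numq p@_m|%N).+1)%N.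

Lemma den_prod_gt0 : (0 < den_prod)%N.
Proof. by apply: prodn_gt0 => m; rewrite absz_gt0 denq_neq0. Qed.

Lemma num_prod_gt0 : (0 < num_prod)%N.
Proof. exact: prodn_gt0. Qed.

Lemma den_num_prod_le : (den_prod * num_prod <= 2 ^ poly_size p)%N.
Proof.
rewrite -big_split /= /poly_size expn_sum leq_prod // => m _.
apply: (@leq_trans (2 ^ coef_size p@_m)%N); last by rewrite leq_exp2l ?leq_addr.
by rewrite expnD mulnC leq_mul ?ltn_bitlen // ltnW ?ltn_bitlen.
Qed.

Definition cleared_terms (D : nat) : seq (int * 'X_{1..n}) :=
  [seq (numq p@_m * (D %/ `|denq p@_m|)%N, m) | m <- msupp p].

Lemma sum_cleared_terms (R : numFieldType) (x : 'I_n -> R) (D : nat) :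
    (den_prod %| D)%N ->
  \sum_(g <- cleared_terms D) g.1%:~R * mmap1 x g.2
    = D%:R * (map_mpoly ratr p).@[x].
Proof.
move=> dvd_D; rewrite big_map mevalE.
rewrite (perm_big _ (msupp_map_mpoly _ (fmorph_inj _))) mulr_sumr.
rewrite big_seq [RHS]big_seq; apply: eq_bigr => m m_supp /=.
rewrite mcoeff_map_mpoly mulrA; congr (_ * _).
have den_dvd : (`|denq p@_m| %| D)%N.
  apply: dvdn_trans dvd_D.
  by rewrite /den_prod (bigD1_seq m) ?msupp_uniq //= dvdn_mulr.
rewrite -[in RHS](divnK den_dvd); set k := (_ %/ _)%N.
have denE : `|denq p@_m|%:R = (denq p@_m)%:~R :> R.
  by rewrite -[in RHS](@gtz0_abs (denq _)) ?denq_gt0.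
rewrite natrM rmorphM /= /ratr denE -[k%:~R]/(k%:R).
by field; rewrite intr_eq0 denq_neq0.
Qed.

Lemma sum_norm_cleared_terms_le D :
  (D + \sum_(g <- cleared_terms D) `|g.1| <= D * num_prod)%N.
Proof.
apply: leq_trans (leq_mul (leqnn D) (leq_addn_sum_prodS _ _)).
rewrite big_map mulnDr muln1 leq_add2l big_distrr leq_sum // => m _ /=.
by rewrite abszM mulnC leq_mul2r leq_div orbT.
Qed.

End ClearedDenominators.

Section IntegralSystem.
Variables (n : nat) (P : 'I_n -> {mpoly rat[n]}).

Lemma poly_size_le_enc_size i : (poly_size (P i) <= enc_size P)%N.
Proof. by rewrite /enc_size (bigD1 i) //= leq_addr. Qed.

Definition common_den : nat := (\prod_i den_prod (P i))%N.

Lemma common_den_gt0 : (0 < common_den)%N.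
Proof. by apply: prodn_gt0 => i; apply: den_prod_gt0. Qed.

(* The terms of [common_den * (P_i - x_i)]. *)
Definition integral_terms i : seq (int * 'X_{1..n}) :=
  (- common_den%:Z, U_(i)%MM) :: cleared_terms (P i) common_den.

Lemma sum_integral_terms (R : numFieldType) (x : 'I_n -> R) i :
  \sum_(g <- integral_terms i) g.1%:~R * mmap1 x g.2
    = common_den%:R * ((map_mpoly ratr (P i)).@[x] - x i).
Proof.
rewrite big_cons sum_cleared_terms /=; last first.
  by rewrite /common_den (bigD1 i) //= dvdn_mulr.
by rewrite mmap1U rmorphN mulNr mulrBr addrC.
Qed.

Lemma integral_terms_mdeg d i g :
    (0 < d)%N -> (msize (P i) <= d.+1)%N -> g \in integral_terms i ->
  (mdeg g.2 <= d)%N.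
Proof.
move=> d_gt0 size_le; rewrite inE => /predU1P[->|/mapP[m m_supp ->]] /=.
  by rewrite mdeg1.
by rewrite -ltnS (leq_trans (msize_mdeg_lt m_supp)).
Qed.

Lemma sum_norm_integral_terms_le i :
  (\sum_(g <- integral_terms i) `|g.1| <= 2 ^ enc_size P)%N.
Proof.
rewrite big_cons /= abszN; apply: leq_trans (sum_norm_cleared_terms_le _ _) _.
apply: (@leq_trans (\prod_k (den_prod (P k) * num_prod (P k)))%N).
  rewrite big_split leq_mul2l (bigD1 i) //= leq_pmulr ?orbT //.
  by apply: prodn_gt0 => k; apply: num_prod_gt0.
by rewrite expn_sum leq_prod // => k _; apply: den_num_prod_le.
Qed.

End IntegralSystem.

Section MonotonePolynomialSystem.
Variables (R : realType) (n d : nat).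
Variables (P : 'I_n -> {mpoly rat[n]}) (q : 'I_n -> R).
Hypotheses (mpsP : is_MPS P) (lfpq : is_LFP P q).
Hypothesis size_le : forall i, (msize (P i) <= d.+1)%N.

Let Q i : {mpoly R[n]} := map_mpoly ratr (P i).

Let Q_coef_ge0 i m : 0 <= (Q i)@_m.
Proof. by rewrite mcoeff_map_mpoly ler0q mpsP. Qed.

Let Q_supp i m : (m \in msupp (Q i)) = (m \in msupp (P i)).
Proof. exact: perm_mem (msupp_map_mpoly _ (fmorph_inj _)) m. Qed.

Let Q_size_le i : (msize (Q i) <= d.+1)%N.
Proof.
rewrite msizeE; apply/bigmax_leqP_seq => m; rewrite Q_supp => m_supp _.
exact: leq_trans (msize_mdeg_lt m_supp) (size_le i).
Qed.

Lemma is_LFP_least_fixpoint : least_fixpoint (sys_eval Q) q.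
Proof.
case: lfpq => [[q_ge0 qE] q_least].
apply: least_fixpointP => [||i|y y_ge0 fy]; first exact: sys_eval_monotone.
- by [].
- by rewrite [RHS]qE.
- by apply: q_least; split=> // i; rewrite -[LHS]fy.
Qed.

Lemma lfp_lower_bound i :
  (forall i, 0 < q i) -> (2 ^- enc_size P) ^+ (\sum_(k < n) d ^ k) <= q i.
Proof.
move=> q_gt0.
apply: (least_fixpoint_lower_bound Q_coef_ge0 is_LFP_least_fixpoint) => //.
  by rewrite invr_ge0 exprn_ge0 //= invf_le1 ?exprn_gt0 // exprn_ege1 // ler1n.
move=> k m; rewrite Q_supp mcoeff_map_mpoly => m_supp.
have coef_gt0 : 0 < (P k)@_m.
  by rewrite lt_neqAle eq_sym -mcoeff_msupp m_supp mpsP.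
apply: le_trans (ratr_ge_exp_coef_size R coef_gt0).
rewrite lef_pV2 ?posrE ?exprn_gt0 // ler_weXn2l ?ler1n //.
exact: leq_trans (coef_size_le_poly_size m_supp) (poly_size_le_enc_size P k).
Qed.

(* Clearing denominators in [z_i + z_i ^ (d + 1) / h = P_i(z)] gives
   [z_i ^ (d + 1) = u * D * (P_i(z) - z_i)] with [u = h / D]; the coefficients
   below are those of the right-hand side, with ['X] standing for [u]. *)
Definition perturbed_system i : seq ({poly int} * 'X_{1..n}) :=
  [seq (g.1 *: 'X, g.2) | g <- integral_terms P i].

Local Notation eval_int u := (horner_eval u \o map_poly intr).

Lemma perturbed_system_solution (h : R) (z : 'I_n -> R) :
    0 < h -> (forall i, perturb d.+1 h^-1 (z i) = sys_eval Q z i) ->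
  solves_power_system d perturbed_system (eval_int (h / (common_den P)%:R)) z.
Proof.
move=> h_gt0 zE i; have D_gt0 := common_den_gt0 P; rewrite big_map /=.
set u := h / _.
have -> : z i ^+ d.+1 = u * ((common_den P)%:R * (sys_eval Q z i - z i)).
  by rewrite -zE /perturb /u; field; rewrite gt_eqF ?pnatr_eq0 -?lt0n.
rewrite -sum_integral_terms mulr_sumr; apply: eq_bigr => g _.
by rewrite map_polyZ map_polyX /horner_eval hornerZ hornerX mulrCA mulrA.
Qed.

Lemma perturbed_system_norm_le i :
  \sum_(g <- perturbed_system i) l1norm (int_norm R) g.1 <= 2 ^+ enc_size P.
Proof.
rewrite big_map -natrX.
apply: (@le_trans _ _ (\sum_(g <- integral_terms P i) `|g.1|%N)%:R).
  have semiZ := int_norm_ring_seminorm R; rewrite natr_sum ler_sum // => g _ /=.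
  by rewrite -mul_polyC l1norm_MX // l1normC //= -intr_norm.
by rewrite ler_nat sum_norm_integral_terms_le.
Qed.

Local Open Scope classical_set_scope.

Lemma lfp_upper_bound j :
  (0 < d)%N -> q j <= (1 + (2 ^+ enc_size P) ^+ (d * n + 1)) ^+ (d.+1 ^ n).
Proof.
move=> d_gt0; have deg_le i g : g \in perturbed_system i -> (mdeg g.2 <= d)%N.
  by move=> /mapP[h /(integral_terms_mdeg d_gt0 (size_le i)) + ->].
have [|F [F_monic F_norm F_root]] := exists_eliminant R
    (l1norm_ring_seminorm (int_norm_ring_seminorm R))
    _ perturbed_system_norm_le deg_le j.
  by rewrite exprn_ege1 // ler1n.
have [u0 u0_gt0 root_le] := int_bivariate_root_le (q j) (monic_neq0 F_monic).
have [z [z_itv zE z_cvg]] := perturbed_solutions_cvg (ltn0Sn d)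
    (sys_eval_monotone Q_coef_ge0) (@sys_eval_continuous _ _ Q)
    is_LFP_least_fixpoint.
apply: le_trans F_norm; apply: (cvgr_to_le (z_cvg j)); near=> k.
have D_gt0 : 0 < (common_den P)%:R :> R by rewrite ltr0n common_den_gt0.
apply: (root_le (k.+1%:R / (common_den P)%:R)) (z_itv k j) _.
  rewrite ler_pdivlMr // -natr1 ler_wpDr //.
  by near: k; apply: nbhs_infty_ger.
have /rootP := F_root _ _ (perturbed_system_solution (ltr0Sn R k) (zE k)).
rewrite map_poly_comp => rootF.
by rewrite -/(horner_eval _ _) -horner_map /= /horner_eval hornerC.
Unshelve. all: by end_near. Qed.

End MonotonePolynomialSystem.

Lemma log2_ge1 (R : realType) (x : R) : 2 <= x -> 1 <= log2 x.
Proof.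
move=> x_ge2; have ln2_gt0 : 0 < ln 2 :> R by rewrite ln_gt0 // ltr1n.
by rewrite /log2 ler_pdivlMr // mul1r ler_ln ?posrE // (lt_le_trans _ x_ge2).
Qed.

Lemma elimination_exponent_le (R : realFieldType) (n s : nat) (l : R) :
    1 <= l ->
  ((1 + s * (2 * n + 1)) * 3 ^ n)%:R
    <= 2 * n.+1%:R * (s%:R + 2 * n.+1%:R * l) * 5 ^+ n.
Proof.
move=> l_ge1; rewrite natrM natrX; apply: ler_pM => //; first exact: exprn_ge0.
  rewrite natrD !natrM natrD !natrM -[n.+1%:R]natr1.
  have : 0 <= n%:R :> R by [].
  have : 0 <= s%:R :> R by [].
  move: (n%:R : R) (s%:R : R) => a b b_ge0 a_ge0.
  have ab_ge0 : 0 <= a * b by rewrite mulr_ge0.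
  have al_ge1 : 1 <= (a + 1) ^+ 2 * l.
    by rewrite mulr_ege1 // exprn_ege1 // lerDr.
  lra.
by rewrite lerXn2r ?nnegrE // ler_nat.
Qed.

Theorem theorem1 (R : realType) (n : nat) (n_gt0 : (0 < n)%N)
    (P : 'I_n -> {mpoly rat[n]}) (q : 'I_n -> R)
    (mpsP : is_MPS P) (quadP : quadratic P)
    (lfpq : is_LFP P q) (q_gt0 : forall i, 0 < q i) :
  (2 : R) ^- (enc_size P * (2 ^ n - 1)) <= vec_min n_gt0 q
  /\
  vec_max n_gt0 q <=
    2 `^ (2 * (n.+1)%:R
          * ((enc_size P)%:R + 2 * (n.+1)%:R * log2 (2 * n%:R + 2))
          * 5 ^+ n).
Proof.
split.
  have lower i := lfp_lower_bound mpsP lfpq quadP i q_gt0.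
  by rewrite exprM -exprVn subn1 predn_exp mul1n; apply: le_bigmin => [|i _].
set s := enc_size P.
suff upper i : q i <= 2 ^+ ((1 + s * (2 * n + 1)) * 3 ^ n).
  apply: (@le_trans _ _ (2 ^+ ((1 + s * (2 * n + 1)) * 3 ^ n))).
    by apply: bigmax_le.
  rewrite -[leLHS]powR_mulrn //; apply: ler_powR; first by rewrite ler1n.
  by apply: elimination_exponent_le; apply: log2_ge1; rewrite lerDr mulr_ge0.
apply: le_trans (lfp_upper_bound mpsP lfpq quadP i isT) _.
rewrite exprM lerXn2r ?nnegrE ?addr_ge0 ?exprn_ge0 // -exprM exprS.
rewrite [leRHS]mulr_natl [leRHS]mulr2n.
by rewrite lerD2r exprn_ege1 ?ler1n.
Qed.
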